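(* For a partial order $P=(V,\prec_P)$ on a finite set $V$, the following conditions are equivalent: (i) $P$ is a linear-interval order; (ii) $P$ has a linear extension fulfilling the $\mathbf{2+2}$ rule; (iii) $P$ has a linear extension that contains no alternating 4-anticycle.
   Context: A partial order is a pair $P=(V,\prec_P)$ with $V$ finite and $\prec_P$ irreflexive and transitive; it is a linear order if any two distinct elements are comparable. $P$ is an interval order if each $v\in V$ can be assigned a closed real interval $I(v)=[l(v),r(v)]$ such that $u\prec_P v \iff r(u)<l(v)$. The intersection $P_1\cap P_2$ of two partial orders $P_1=(V,\prec_1)$, $P_2=(V,\prec_2)$ on the same ground set is the partial order with $u\prec v \iff (u\prec_1 v$ and $u\prec_2 v)$. $P$ is a linear-interval order if $P=L\cap P_I$ for some linear order $L$ and some interval order $P_I$ on $V$. A linear extension of $P$ is a linear order $L=(V,\prec_L)$ with $u\prec_L v$ whenever $u\prec_P v$. A suborder $\mathbf{2+2}$ of $P$ consists of four distinct elements $a_0,a_1,b_0,b_1$ whose only relations in $P$ (among these four) are $a_0\prec_P b_0$ and $a_1\prec_P b_1$. A linear extension $L$ of $P$ fulfills the $\mathbf{2+2}$ rule if for every such suborder $\mathbf{2+2}$, either $b_0\prec_L a_1$ or $b_1\prec_L a_0$. An alternating $2k$-anticycle of a linear extension $L$ of $P$ is an induced suborder on $2k$ distinct elements $a_0,b_0,a_1,b_1,\dots,a_{k-1},b_{k-1}$ with $a_i\prec_P b_i$, $a_{i+1}\prec_L b_i$ and $a_{i+1}\not\prec_P b_i$ for all $i=0,\dots,k-1$ (indices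 modulo $k$). *)

(* Defs.v *)
From mathcomp Require Import all_boot all_order all_algebra reals.

Set Implicit Arguments.
Unset Strict Implicit.
Unset Printing Implicit Defensive.

Import Order.TTheory GRing.Theory Num.Theory.
Local Open Scope ring_scope.

Definition partial_order (V : finType) (P : rel V) : Prop :=
  irreflexive P /\ transitive P.

Definition linear_order (V : finType) (L : rel V) : Prop :=
  partial_order L /\ (forall u v : V, u != v -> L u v || L v u).

Definition interval_order (R : realType) (V : finType) (P : rel V) : Prop :=
  partial_order P /\
  exists l r : V -> R,
    (forall v : V, l v <= r v) /\ (forall u v : V, P u v = (r u < l v)).

Definition order_inter (V : finType) (P1 P2 : rel V) : rel V :=
  fun u v => P1 u v && P2 u v.

Definition linear_interval_order (R : realType) (V : finType) (P : rel V)
    : Prop :=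
  exists L PI : rel V,
    [/\ linear_order L, interval_order R PI & P =2 order_inter L PI].

Definition linear_extension (V : finType) (P L : rel V) : Prop :=
  linear_order L /\ (forall u v : V, P u v -> L u v).

Definition two_plus_two (V : finType) (P : rel V) (a0 a1 b0 b1 : V) : Prop :=
  uniq [:: a0; a1; b0; b1] /\
  {in [:: a0; a1; b0; b1] &, forall x y : V,
     P x y = ((x, y) == (a0, b0)) || ((x, y) == (a1, b1))}.

Definition two_plus_two_rule (V : finType) (P L : rel V) : Prop :=
  forall a0 a1 b0 b1 : V,
    two_plus_two P a0 a1 b0 b1 -> L b0 a1 \/ L b1 a0.

(* [ordS i] is the cyclic successor of [i : 'I_k]. "Induced suborder" adds no
   condition: the suborder of P on these 2k elements is determined by them. *)
Definition alternating_anticycle (V : finType) (P L : rel V) (k : nat)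
    (a b : 'I_k -> V) : Prop :=
  uniq (codom a ++ codom b) /\
  (forall i : 'I_k,
     [/\ P (a i) (b i), L (a (ordS i)) (b i) & ~~ P (a (ordS i)) (b i)]).

Definition has_alternating_4_anticycle (V : finType) (P L : rel V) : Prop :=
  exists a b : 'I_2 -> V, alternating_anticycle P L a b.

(* Main.v *)
Require Import Defs.
From mathcomp Require Import all_boot all_order all_algebra reals.

Set Implicit Arguments.
Unset Strict Implicit.
Unset Printing Implicit Defensive.

Import Order.TTheory GRing.Theory Num.Theory.

(** For a fixed linear extension [L], suborders 2+2 violating the 2+2 rule and
    alternating 4-anticycles are the same configurations [a0 < b0], [a1 < b1].
    If [P] is the intersection of [L] and an interval order with endpoints [l]
    and [r], such a configuration would give
    [r a0 < l b0 <= r a1 < l b1 <= r a0].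

    Conversely, endpoints of a suitable interval order must satisfy
    [r a < l b] when [a <_P b], and [l b <= r a] when [a <=_L b] but not
    [a <_P b].  Eliminating [r] leaves the constraints [l b < l b'] for
    [before b b'] below.  A cycle of such constraints can be shortened next to
    its [L]-maximal element unless there is an alternating 4-anticycle; hence
    [before] is acyclic, and counting predecessors yields [l]. *)

Section LinearExtension.

Variables (V : finType) (P L : rel V).
Hypotheses (hP : partial_order P) (hL : linear_extension P L).

Let Pirr : irreflexive P. Proof. exact: hP.1. Qed.
Let Ptr : transitive P. Proof. exact: hP.2. Qed.
Let Lirr : irreflexive L. Proof. exact: hL.1.1.1. Qed.
Let Ltr : transitive L. Proof. exact: hL.1.1.2. Qed.
Let PL u v : P u v -> L u v. Proof. exact: hL.2. Qed.

(** * Violations of the 2+2 rule and anticycles *)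

Lemma linext_asym u v : L u v -> L v u = false.
Proof. by move=> uv; apply/negP => /(Ltr uv); rewrite Lirr. Qed.

(** An alternating 4-anticycle with its indices written out; distinctness is left out because it
    follows from the relations. *)
Definition crossing (a0 a1 b0 b1 : V) : Prop :=
  [/\ P a0 b0, P a1 b1, L a1 b0 & L a0 b1] /\ ~~ P a1 b0 /\ ~~ P a0 b1.

Lemma crossing_uniq a0 a1 b0 b1 :
  crossing a0 a1 b0 b1 -> uniq [:: a0; a1; b0; b1].
Proof.
case=> [[p0 p1 l10 l01] [n10 n01]]; rewrite /= !inE !negb_or !andbT.
apply/and3P; split; [apply/and3P; split | apply/andP; split |].
- by apply: contraNneq n01 => ->.
- by apply: contraTneq p0 => ->; rewrite Pirr.
- by apply: contraTneq l01 => ->; rewrite Lirr.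
- by apply: contraTneq l10 => ->; rewrite Lirr.
- by apply: contraTneq p1 => ->; rewrite Pirr.
- by apply: contraNneq n01 => <-.
Qed.

Lemma anticycle_crossing :
  has_alternating_4_anticycle P L <->
  exists a0 a1 b0 b1, crossing a0 a1 b0 b1.
Proof.
have o1 : ordS (ord0 : 'I_2) = ord_max by exact: val_inj.
have o0 : ordS (ord_max : 'I_2) = ord0 by exact: val_inj.
split=> [[a [b [_ h]]]|[a0 [a1 [b0 [b1 c]]]]].
  exists (a ord0), (a ord_max), (b ord0), (b ord_max).
  have [p0 l0 n0] := h ord0; have [p1 l1 n1] := h ord_max.
  by rewrite o1 in l0 n0; rewrite o0 in l1 n1.
exists (fun i => if i == ord0 then a0 else a1).
exists (fun i => if i == ord0 then b0 else b1); split.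
  by rewrite /codom /image_mem !enum_ordSl enum_ord0 /=; apply: crossing_uniq.
case: c => [[p0 p1 l10 l01] [n10 n01]] i.
have [->|->] : i = ord0 \/ i = ord_max.
- by case: i => [[|[|//]] ?]; [left|right]; exact: val_inj.
- by rewrite o1.
- by rewrite o0.
Qed.

(** Since [L] is total, failure of both options of the rule means exactly [L a1 b0] and
    [L a0 b1]. *)
Lemma two_plus_two_crossing a0 a1 b0 b1 :
  crossing a0 a1 b0 b1 <->
  [/\ two_plus_two P a0 a1 b0 b1, ~~ L b0 a1 & ~~ L b1 a0].
Proof.
have PF x y : L x y -> P y x = false.
  by move/linext_asym => xy; apply: contraFF xy; apply: PL.
split=> [c|[[u h] n0 n1]]; last first.
  move: u; rewrite /= !inE !negb_or !andbT.
  case/and3P=> /and3P[na _ d01] /andP[d10 _] nb.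
  have mem := (inE, eqxx, orbT).
  have tot x y : x != y -> ~~ L y x -> L x y.
    by move=> d n; have := hL.1.2 _ _ d; rewrite (negbTE n) orbF.
  split; first by split; [rewrite h !mem | rewrite h !mem | exact: tot..].
  by split; rewrite h ?mem // !xpair_eqE ?(eq_sym a1 a0) ?(eq_sym b1 b0)
    (negbTE na) (negbTE nb) ?andbF.
have u := crossing_uniq c.
case: c => [[p0 p1 l10 l01] [n10 n01]].
split; [split=> // | by rewrite linext_asym | by rewrite linext_asym].
move: u; rewrite /= !inE !negb_or !andbT.
case/and3P=> /and3P[/negbTE na /negbTE d00 /negbTE d01].
case/andP=> /negbTE d10 /negbTE d11 /negbTE nb.
(* A relation among the [a]s or among the [b]s would compose with [p0] or [p1] to an excluded cross
   relation. *)
have naa : P a0 a1 = false by apply: contraNF n01 => /Ptr; apply.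
have naa' : P a1 a0 = false by apply: contraNF n10 => /Ptr; apply.
have nbb : P b0 b1 = false by apply: contraNF n01; apply: Ptr.
have nbb' : P b1 b0 = false by apply: contraNF n10; apply: Ptr.
have E := (naa, naa', nbb, nbb', p0, p1, negbTE n10, negbTE n01,
  PF _ _ (PL p0), PF _ _ (PL p1), PF _ _ l10, PF _ _ l01, Pirr).
have D := (eqxx, na, d00, d01, d10, d11, nb, andbF).
have D' := (eq_sym a1 a0, eq_sym b0 a0, eq_sym b1 a0, eq_sym b0 a1,
  eq_sym b1 a1, eq_sym b1 b0).
by move=> x y; rewrite !inE => /or4P[]/eqP-> /or4P[]/eqP->;
  rewrite E !xpair_eqE ?D' !D.
Qed.

Lemma two_plus_two_rule_anticycle :
  two_plus_two_rule P L <-> ~ has_alternating_4_anticycle P L.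
Proof.
rewrite anticycle_crossing; split.
  move=> rule [a0 [a1 [b0 [b1 /two_plus_two_crossing[t n0 n1]]]]].
  by have [] := rule _ _ _ _ t; apply/negP.
move=> nc a0 a1 b0 b1 t.
case l0: (L b0 a1); first by left.
case l1: (L b1 a0); first by right.
case: nc; exists a0, a1, b0, b1; apply/two_plus_two_crossing.
by rewrite l0 l1.
Qed.

(** * Acyclicity of the constraints on left endpoints *)

Let leL : rel V := fun u v => (u == v) || L u v.

Let leL_trans : transitive leL.
Proof.
move=> y x z /orP[/eqP->//|xy] /orP[/eqP<-|yz]; rewrite /leL.
  by rewrite xy orbT.
by rewrite (Ltr xy yz) orbT.
Qed.

Lemma linext_max x0 (s : seq V) :
  exists2 x, x \in x0 :: s & forall y, y \in x0 :: s -> leL y x.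
Proof.
elim: s x0 => [|y s IH] x0.
  by exists x0; rewrite ?mem_head // => y; rewrite inE /leL => ->.
have [x xs xmax] := IH y.
have [le|nle] := boolP (leL x0 x).
  exists x; first by rewrite inE xs orbT.
  by move=> z; rewrite inE => /predU1P[->//|]; apply: xmax.
exists x0; first exact: mem_head.
have lt : leL x x0.
  move: nle; rewrite /leL negb_or => /andP[d n].
  by have := hL.1.2 _ _ d; rewrite (negbTE n) /= => ->; rewrite orbT.
move=> z; rewrite inE => /predU1P[->|/xmax zx]; first by rewrite /leL eqxx.
exact: leL_trans zx lt.
Qed.

Definition before : rel V :=
  fun b b' => [exists a, [&& leL a b, ~~ P a b & P a b']].

Hypothesis no_anticycle : ~ has_alternating_4_anticycle P L.

(** The witness [a2] of the second step also lies weakly below [b0] in [L], so it serves for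
    [before b0 b2] unless [P a2 b0]; in that case [a2], [a1], [b0], [b1] form a crossing. *)
Lemma before_shortcut b0 b1 b2 :
  leL b1 b0 -> before b0 b1 -> before b1 b2 -> before b0 b2.
Proof.
move=> b10 /existsP[a1 /and3P[l10 n10 p11]] /existsP[a2 /and3P[l21 n21 p22]].
apply/existsP; exists a2; rewrite (leL_trans l21 b10) p22 andbT /=.
apply/negP => p20; apply/no_anticycle/anticycle_crossing.
exists a2, a1, b0, b1; split=> //; split=> //.
(* Equality [a1 = b0] would give the chain [a2], [b0], [b1] in [P]; [a2 = b1] is excluded in the
   same way. *)
- case/orP: l10 => // /eqP e; case/negP: n21.
  by apply: Ptr p20 _; rewrite -e.
- case/orP: l21 => // /eqP e; case/negP: n10.
  by apply: Ptr p11 _; rewrite -e.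
Qed.

(** Rotation puts an [L]-maximal element [x] first. Its successor can then be dropped and [x] stays
    maximal, so induction reaches a loop at [x], whose witness [a] would satisfy both [P a x] and
    its negation. *)
Lemma before_acyclic x s : ~~ cycle before (x :: s).
Proof.
wlog xmax : x s / forall y, y \in s -> leL y x => [wl|].
  have [z zs zmax] := linext_max x s.
  have [i s' E] := rot_to zs.
  rewrite -(rot_cycle i) E; apply: wl => y ys.
  by apply: zmax; rewrite -(mem_rot i) E inE ys orbT.
elim: s xmax => [|y s IH] xmax.
  by rewrite /= andbT; apply/existsP => -[a /and3P[_ /negbTE->]].
apply/negP => c.
have {}IH : ~~ cycle before (x :: s).
  by apply: IH => z zs; apply: xmax; rewrite inE zs orbT.
case/negP: IH; move: c => /= /andP[xy].
have yx : leL y x by apply: xmax; rewrite mem_head.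
by case: s {xmax} => [|z s] /= /andP[yz ?];
  rewrite (before_shortcut yx xy yz).
Qed.

(** * Endpoints of the interval order *)

Definition left_end (b : V) : nat := #|[pred b' | connect before b' b]|.

Lemma before_left_end b b' : before b b' -> left_end b < left_end b'.
Proof.
move=> bb'; apply: proper_card; apply/properP; split.
  apply/subsetP => c; rewrite !inE => /connect_trans; apply.
  exact: connect1.
(* The inclusion is strict at [b']: a path from [b'] back to [b] would close a cycle. *)
exists b'; rewrite !inE ?connect0 //.
apply/connectP => -[p bp eb]; case/negP: (before_acyclic b' p).
by rewrite /= rcons_path bp -eb.
Qed.

Definition right_end (a : V) : nat :=
  \max_(b | leL a b && ~~ P a b) left_end b.

Lemma left_le_right_end a b :
  leL a b -> ~~ P a b -> left_end b <= right_end a.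
Proof. by move=> l n; apply: leq_bigmax_cond; rewrite l. Qed.

Lemma right_lt_left_end a b : P a b -> right_end a < left_end b.
Proof.
move=> p; rewrite /right_end.
(* The index set contains [a], so the maximum is attained at some [c] and is not the default 0; [a]
   then witnesses [before c b]. *)
have [|c /andP[l n] ->] := @eq_bigmax_cond _
    [pred b | leL a b && ~~ P a b] left_end.
  by apply/card_gt0P; exists a; rewrite inE /leL eqxx Pirr.
by apply: before_left_end; apply/existsP; exists a; rewrite l n p.
Qed.

End LinearExtension.

(** * The equivalences *)

Local Open Scope ring_scope.

Lemma linear_interval_order_anticycle (R : realType) (V : finType)
    (P : rel V) (hP : partial_order P) :
  linear_interval_order R P <->
  exists L : rel V, linear_extension P L /\ ~ has_alternating_4_anticycle P L.
Proof.
split=> [[L [I [hL [_ [l [r [lr EI]]]] EP]]]|[L [hL nac]]].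
  have ext : linear_extension P L.
    by split=> // u v; rewrite EP => /andP[].
  exists L; split=> // /(anticycle_crossing hP ext).
  move=> [a0 [a1 [b0 [b1 [[p0 p1 l10 l01] [n10 n01]]]]]].
  (* The cross pairs are related in [L], so their failure in [P] is a failure in the interval
     order. *)
  move: p0 p1 n10 n01; rewrite !EP /order_inter l10 l01 /= !EI -!leNgt.
  move=> /andP[_ p0] /andP[_ p1] n10 n01.
  have := lt_le_trans (lt_trans (lt_le_trans p0 n10) p1) n01.
  by rewrite ltxx.
pose l v : R := (left_end P L v)%:R.
pose r v : R := (right_end P L v)%:R.
have lr v : l v <= r v.
  by rewrite ler_nat left_le_right_end ?eqxx ?hP.1.
exists L, (fun u v => r u < l v); split; first exact: hL.1.
- split; last by exists l, r.
  split=> [v|v u w uv vw]; first by rewrite ltNge lr.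
  exact: lt_trans (lt_le_trans uv (lr v)) vw.
- move=> u v; apply/idP/andP => [p|[Luv]].
    by rewrite hL.2 // ltr_nat right_lt_left_end.
  rewrite ltr_nat; apply: contraTT => n.
  by rewrite -leqNgt left_le_right_end // Luv orbT.
Qed.

Theorem theorem1 (R : realType) (V : finType) (P : rel V)
    (hP : partial_order P) :
  (linear_interval_order R P <->
     exists L : rel V, linear_extension P L /\ two_plus_two_rule P L) /\
  ((exists L : rel V, linear_extension P L /\ two_plus_two_rule P L) <->
     exists L : rel V,
       linear_extension P L /\ ~ has_alternating_4_anticycle P L).
Proof.
have E : (exists L : rel V, linear_extension P L /\ two_plus_two_rule P L) <->
    exists L : rel V,
      linear_extension P L /\ ~ has_alternating_4_anticycle P L.
  by split=> -[L [hL h]]; exists L; split=> //;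
    apply/(two_plus_two_rule_anticycle hP hL).
by split=> //; rewrite E; apply: linear_interval_order_anticycle.
Qed.
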